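(* Let $\mathcal{S}$ be an alphabet and let $\mathcal{C}$ be any covering family of languages on $\mathcal{S}$. There exist a complete graph $\mathcal{G}_{\mathcal{C}}=(N_{\mathcal{C}},E_{\mathcal{C}})$ on $\mathcal{S}$ and a one-to-one correspondence (bijection) $\Phi:N_{\mathcal{C}}\to\mathcal{C}$ such that, for any $n$ and any system $F=\{f_i\}_{i\in\mathcal{S}}$ of continuous maps $f_i:\mathbb{R}^n\to\mathbb{R}^n$, the following holds: a function $W:\mathcal{C}\times\mathbb{R}^n\to\mathbb{R}$ is a $\mathcal{C}$-memory-based Lyapunov function for $F$ if and only if $\big(\{W(\Phi(s),\cdot)\}_{s\in N_{\mathcal{C}}},\,\mathcal{G}_{\mathcal{C}}\big)$ is a path-complete Lyapunov function for $F$.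
   Context: An alphabet $\mathcal{S}$ is a finite nonempty set of symbols. $\mathcal{S}^\star=\bigcup_{k\in\mathbb{N}}\mathcal{S}^k$ is the set of all finite strings over $\mathcal{S}$, with $\mathcal{S}^0=\{\epsilon\}$ (the empty string). For $h\in\mathcal{S}$ and a string $w=(i_1,\dots,i_K)$, $hw=(h,i_1,\dots,i_K)$ is the string obtained by prepending $h$; for $B\subseteq\mathcal{S}^\star$, $hB=\{hw : w\in B\}$. A regular language is a subset of $\mathcal{S}^\star$ recognized by a finite-state automaton. Covering family of languages: a finite set $\mathcal{C}=\{B_1,\dots,B_M\}$ of regular languages $B_j\subseteq\mathcal{S}^\star$ such that (i) $\bigcup_{j=1}^M B_j=\mathcal{S}^\star$; (ii) for every $B\in\mathcal{C}$ and every $h\in\mathcal{S}$ there exists $C\in\mathcal{C}$ with $hB\subseteq C$. Graph on $\mathcal{S}$: a pair $\mathcal{G}=(N,E)$ with $N$ a finite set of nodes and $E\subseteq N\times N\times\mathcal{S}$ a set of labeled directed edges ($(a,b,i)$ goes from $a$ to $b$ with label $i$). It is complete if for every $a\in N$ and $i\in\mathcal{S}$ there exists $b\in N$ with $(a,b,i)\in E$. It is path-complete if for every $K\ge1$ and every $(j_1,\dots,j_K)\in\mathcal{S}^K$ there are nodes $a_1,\dots,a_{K+1}\in N$ with $(a_k,a_{k+1},j_k)\in E$ for all $1\le k\le K$. A function $\alpha:[0,\infty)\to[0,\infty)$ is of class $\mathcal{K}_\infty$ if it is continuous, strictly increasing, unbounded and $\alpha(0)=0$. $|\cdot|$ is the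 Euclidean norm on $\mathbb{R}^n$. Path-complete Lyapunov function (PCLF) for $F=\{f_i\}_{i\in\mathcal{S}}$: a pair $(V,\mathcal{G})$ where $\mathcal{G}=(N,E)$ is a path-complete graph on $\mathcal{S}$ and $V=\{V_s\}_{s\in N}$ is a family of continuous functions $V_s:\mathbb{R}^n\to\mathbb{R}$ such that, for some $\alpha_1,\alpha_2\in\mathcal{K}_\infty$ and some $\gamma\in[0,1)$: $\alpha_1(|x|)\le V_s(x)\le\alpha_2(|x|)$ for all $s\in N$, $x\in\mathbb{R}^n$; and $V_b(f_i(x))\le\gamma V_a(x)$ for all $(a,b,i)\in E$, $x\in\mathbb{R}^n$. $\mathcal{C}$-memory-based Lyapunov function for $F$: a function $W:\mathcal{C}\times\mathbb{R}^n\to\mathbb{R}$, continuous (i.e. $W(B,\cdot)$ is continuous for each $B\in\mathcal{C}$), for which there exist $\alpha_1,\alpha_2\in\mathcal{K}_\infty$ and $\gamma\in[0,1)$ such that $\alpha_1(|x|)\le W(B,x)\le\alpha_2(|x|)$ for all $(B,x)\in\mathcal{C}\times\mathbb{R}^n$; and $W(C,f_h(x))\le\gamma W(B,x)$ for all $B\in\mathcal{C}$, all $h\in\mathcal{S}$, all $C\in\mathcal{C}$ with $hB\subseteq C$, and all $x\in\mathbb{R}^n$. *)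

(* Defs.v *)
From HB Require Import structures.
From mathcomp Require Import all_boot all_order all_algebra.
From mathcomp Require Import all_classical all_reals all_analysis.

Set Implicit Arguments.
Unset Strict Implicit.
Unset Printing Implicit Defensive.

Import Order.TTheory GRing.Theory Num.Theory.
Import numFieldNormedType.Exports.

Local Open Scope classical_set_scope.
Local Open Scope ring_scope.

Definition language (S : finType) := set (seq S).

Record automaton (S : finType) := Automaton {
  state : finType;
  init : state;
  trans : state -> S -> state;
  accepting : {set state} }.

Definition recognizes (S : finType) (A : automaton S) (B : language S) : Prop :=
  forall w : seq S, B w <-> foldl (@trans S A) (init A) w \in accepting A.

Definition regular (S : finType) (B : language S) : Prop :=
  exists A : automaton S, recognizes A B.

Definition prepend (S : finType) (h : S) (B : language S) : language S :=
  [set h :: w | w in B].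

Definition covering_family (S : finType) (C : set (language S)) : Prop :=
  [/\ finite_set C,
      forall B, C B -> regular B,
      \bigcup_(B in C) B = [set: seq S]
    & forall B, C B -> forall h : S, exists2 D, C D & prepend h B `<=` D].

Record graph (S : finType) := Graph {
  node : finType;
  edge : set (node * node * S) }.

Definition complete (S : finType) (G : graph S) : Prop :=
  forall (a : node G) (i : S), exists b : node G, edge (a, b, i).

(* [lift ord0 k] has value [k.+1]. *)
Definition path_complete (S : finType) (G : graph S) : Prop :=
  forall K : nat, (1 <= K)%N -> forall j : 'I_K -> S,
  exists a : 'I_K.+1 -> node G,
  forall k : 'I_K, edge (a (widen_ord (leqnSn K) k), a (lift ord0 k), j k).

(* A map from [0, +oo[ to itself is represented by a function on R of which
   only the restriction to [0, +oo[ matters. *)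
Definition class_Kinfty (R : realType) (alpha : R -> R) : Prop :=
  [/\ forall r, 0 <= r -> 0 <= alpha r,
      {within [set r : R | 0 <= r], continuous alpha},
      forall r s, 0 <= r -> r < s -> alpha r < alpha s,
      forall M, exists2 r, 0 <= r & M < alpha r
    & alpha 0 = 0].

(* The library norm on matrices is the sup norm. *)
Definition euclidean_norm (R : realType) (n : nat) (x : 'rV[R]_n) : R :=
  Num.sqrt (\sum_(i < n) x 0 i ^+ 2).

Definition is_PCLF (R : realType) (n : nat) (S : finType)
    (F : S -> 'rV[R]_n -> 'rV[R]_n)
    (G : graph S) (V : node G -> 'rV[R]_n -> R) : Prop :=
  [/\ path_complete G,
      forall s : node G, continuous (V s)
    & exists alpha1 alpha2 : R -> R, exists gamma : R,
      [/\ class_Kinfty alpha1, class_Kinfty alpha2, 0 <= gamma < 1,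
          forall (s : node G) (x : 'rV[R]_n),
            alpha1 (euclidean_norm x) <= V s x <= alpha2 (euclidean_norm x)
        & forall (a b : node G) (i : S), edge (a, b, i) ->
            forall x : 'rV[R]_n, V b (F i x) <= gamma * V a x]].

(* [C] used as a type is [{B | B \in C}], and [val] recovers the language. *)
Definition is_memory_based_LF (R : realType) (n : nat) (S : finType)
    (F : S -> 'rV[R]_n -> 'rV[R]_n)
    (C : set (language S)) (W : C -> 'rV[R]_n -> R) : Prop :=
  (forall B : C, continuous (W B)) /\
  exists alpha1 alpha2 : R -> R, exists gamma : R,
    [/\ class_Kinfty alpha1, class_Kinfty alpha2, 0 <= gamma < 1,
        forall (B : C) (x : 'rV[R]_n),
          alpha1 (euclidean_norm x) <= W B x <= alpha2 (euclidean_norm x)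
      & forall (B : C) (h : S) (D : C), prepend h (val B) `<=` val D ->
          forall x : 'rV[R]_n, W D (F h x) <= gamma * W B x].

(* Main.v *)
(** Take one node per language of [C], with an edge [(a, b, h)] exactly when
    [h Phi(a)] is included in [Phi(b)]: the two sets of Lyapunov inequalities
    then coincide.  Condition (ii) on covering families says that this graph is
    complete, and a complete graph with at least one node is path-complete. *)

Require Import Defs.
From mathcomp Require Import all_boot all_order all_algebra.
From mathcomp Require Import all_classical all_reals all_analysis.
Import numFieldNormedType.Exports.
Local Open Scope classical_set_scope.
Local Open Scope ring_scope.

(** The nodes of a [graph] form a [finType]; this lets ordinals stand for the languages of [C]. *)
Lemma finite_set_bij_ord {T : Type} (A : set T) :
  finite_set A -> exists (n : nat) (f : 'I_n -> A), bijective f.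
Proof.
move=> [n /card_bijP[f [g fK gK]]].
have In (i : 'I_n) : (i : nat) \in `I_n by apply/mem_set/ltn_ord.
exists n, (fun i => g (SigSub (In i))).
exists (fun x => Ordinal (set_mem (valP (f x)))) => [i|x].
  by apply/val_inj; rewrite /= gK.
by rewrite -[RHS]fK; congr g; apply/val_inj.
Qed.

(** Completeness gives a successor function, which is iterated from [a0] along the word. *)
Lemma complete_path_complete {S : finType} {G : graph S} (a0 : node G) :
  complete G -> path_complete G.
Proof.
move=> Gc [//|K] _ j.
have [next nextP] := choice (fun p : node G * S => Gc p.1 p.2).
(* [walk] is defined on all of [nat]; [inord] is exact on the indices up to [K], the only ones that
   matter. *)
pose walk := fix walk k := if k is k'.+1 then next (walk k', j (inord k')) else a0.
exists (fun k => walk k) => k.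
have -> : nat_of_ord (lift ord0 k) = k.+1 by [].
by have := nextP (walk k, j (inord k)); rewrite /= inord_val.
Qed.

Theorem theorem1 (R : realType) (S : finType) (S_nonempty : (0 < #|S|)%N)
    (C : set (language S)) (C_covering : covering_family C) :
  exists (G : graph S) (Phi : node G -> C),
    [/\ complete G,
        bijective Phi
      & forall (n : nat) (F : S -> 'rV[R]_n -> 'rV[R]_n),
          (forall i : S, continuous (F i)) ->
          forall W : C -> 'rV[R]_n -> R,
            is_memory_based_LF F W <-> is_PCLF F (fun s : node G => W (Phi s))].
Proof.
have [Cfin _ Ccover Cprep] := C_covering.
have [m [Phi Phi_bij]] := finite_set_bij_ord C Cfin.
have [Psi PhiK PsiK] := Phi_bij.
pose G := @Graph S 'I_m
  [set e | prepend e.2 (val (Phi e.1.1)) `<=` val (Phi e.1.2)].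
have Gc : complete G.
  move=> a i; have [D CD sub] := Cprep _ (set_mem (valP (Phi a))) i.
  by exists (Psi (SigSub (mem_set CD))); rewrite /= PsiK.
have Gpc : path_complete G.
  (* Some language of [C] contains the empty word, so the graph has a node. *)
  have [B CB _] : (\bigcup_(B in C) B) [::] by rewrite Ccover.
  exact: (complete_path_complete (Psi (SigSub (mem_set CB)) : node G)).
exists G, Phi; split=> // n F _ W; split.
- move=> [Wcont [a1 [a2 [g [a1K a2K g01 Wbound Wdec]]]]].
  by split=> //; exists a1, a2, g; split=> // a b i /Wdec.
- move=> [_ Wcont [a1 [a2 [g [a1K a2K g01 Wbound Wdec]]]]]; split.
    (* Every language is [Phi (Psi B)], so properties at all nodes transfer to all of [C]. *)
    by move=> B; rewrite -(PsiK B).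
  exists a1, a2, g; split=> // [B x|B h D sub x].
    by rewrite -(PsiK B).
  rewrite -(PsiK B) -(PsiK D); apply: Wdec.
  by rewrite /= !PsiK.
Qed.
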